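(* Suppose $\lambda_1>0$ and $\lambda_2>0$, and let $x^*\in\Omega$. Then the following two statements are equivalent: (i) $x^*$ is a local minimizer of the problem $\min_{x\in\Omega} F(x)$, where $F(x)=f(x)+\lambda_1\|x_+\|_0+\lambda_2\|x_-\|_0$; (ii) $x^*$ is a global minimizer of $f$ on the set $\Omega_{\Gamma^c(x^* )}:=\{x\in\Omega : x_i=0\ \text{for all } i\in\Gamma^c(x^* )\}$.
   Context: $f:\mathbb{R}^n\to\mathbb{R}$ is a convex differentiable function whose gradient is $L_f$-Lipschitz continuous. $\Omega=\{x\in\mathbb{R}^n: l_i\le x_i\le u_i,\ i=1,\dots,n\}$ with $-\infty\le l_i\le 0\le u_i\le+\infty$ and $l_i<u_i$ for all $i$. For $x\in\mathbb{R}^n$, $\|x_+\|_0$ is the number of indices $i$ with $x_i>0$ and $\|x_-\|_0$ is the number of indices $i$ with $x_i<0$. $\Gamma(x)=\{i\in\{1,\dots,n\}: x_i\ne 0\}$ and $\Gamma^c(x)=\{1,\dots,n\}\setminus\Gamma(x)$. A local minimizer of $\min_{x\in\Omega}F(x)$ is a point $x^*\in\Omega$ such that for some $\delta>0$, $F(x^* )\le F(x)$ for all $x\in\Omega$ with $\|x-x^*\|\le\delta$. *)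

(* Defs.v *)
From HB Require Import structures.
From mathcomp Require Import all_boot all_order all_algebra.
From mathcomp Require Import all_classical all_reals all_analysis.
Set Implicit Arguments.
Unset Strict Implicit.
Unset Printing Implicit Defensive.
Import Order.TTheory GRing.Theory Num.Theory.
Import numFieldNormedType.Exports.
Local Open Scope classical_set_scope.
Local Open Scope ring_scope.

(* The norm `|x| that the library puts on 'rV[R]_n is the sup norm, so the
   Euclidean norm of R^n is defined here. *)
Definition enorm (R : realType) (n : nat) (x : 'rV[R]_n) : R :=
  Num.sqrt (\sum_(i < n) x 0 i ^+ 2).

Definition gradient (R : realType) (n : nat) (f : 'rV[R]_n -> R)
    (x : 'rV[R]_n) : 'rV[R]_n :=
  \row_(i < n) 'D_(delta_mx 0 i) f x.

Definition gradient_lipschitz (R : realType) (n : nat) (L : R)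
    (f : 'rV[R]_n -> R) : Prop :=
  forall x y : 'rV[R]_n,
    enorm (gradient f x - gradient f y) <= L * enorm (x - y).

(* The bounds are extended reals, so a coordinate may be unbounded. *)
Definition box (R : realType) (n : nat) (l u : 'I_n -> \bar R) :
    set 'rV[R]_n :=
  [set x | forall i, (l i <= (x 0 i)%:E)%E /\ ((x 0 i)%:E <= u i)%E].

Definition num_pos (R : realType) (n : nat) (x : 'rV[R]_n) : nat :=
  #|[set i : 'I_n | 0 < x 0 i]%SET|.

Definition num_neg (R : realType) (n : nat) (x : 'rV[R]_n) : nat :=
  #|[set i : 'I_n | x 0 i < 0]%SET|.

Definition objective (R : realType) (n : nat) (f : 'rV[R]_n -> R)
    (lambda1 lambda2 : R) (x : 'rV[R]_n) : R :=
  f x + lambda1 * (num_pos x)%:R + lambda2 * (num_neg x)%:R.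

Definition Gamma (R : realType) (n : nat) (x : 'rV[R]_n) : {set 'I_n} :=
  [set i | x 0 i != 0]%SET.

Definition vanishing_on (R : realType) (n : nat) (A : set 'rV[R]_n)
    (I : {set 'I_n}) : set 'rV[R]_n :=
  [set x | A x /\ forall i, i \in I -> x 0 i = 0].

Definition local_minimizer (R : realType) (n : nat) (A : set 'rV[R]_n)
    (F : 'rV[R]_n -> R) (xs : 'rV[R]_n) : Prop :=
  A xs /\ exists2 delta : R, 0 < delta &
    forall x, A x -> enorm (x - xs) <= delta -> F xs <= F x.

Definition global_minimizer (R : realType) (n : nat) (A : set 'rV[R]_n)
    (F : 'rV[R]_n -> R) (xs : 'rV[R]_n) : Prop :=
  A xs /\ forall x, A x -> F xs <= F x.

(* Main.v *)
Require Import Defs.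
From HB Require Import structures.
From mathcomp Require Import all_boot all_order all_algebra.
From mathcomp Require Import all_classical all_reals all_analysis.
Import Order.TTheory GRing.Theory Num.Theory.
Import numFieldNormedType.Exports.
Local Open Scope classical_set_scope.
Local Open Scope ring_scope.

(** The penalty [lambda1 * num_pos + lambda2 * num_neg] depends only on the
    signs of the coordinates. Near [xs] the nonzero coordinates keep their
    sign, so a nearby point either has the same support, and then exactly the
    same penalty ([num_same_support]), or it has a new nonzero coordinate, and
    then its penalty exceeds that of [xs] by at least [min lambda1 lambda2]
    ([penalty_gap]).

    If [xs] is a local minimizer of the objective and [x] is in the face of the box where
    the coordinates outside the support of [xs] vanish, then short steps from
    [xs] towards [x] stay in the face and keep the penalty. Hence [f] does not
    decrease along them, and convexity carries this inequality along the
    segment up to [x].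

    Conversely, let [xs] minimize [f] on the face. A nearby point of the box in
    the face has the same penalty and no smaller [f]; for one outside the face,
    continuity of [f] at [xs] makes the decrease of [f] less than the jump
    [min lambda1 lambda2] of the penalty. *)

Lemma coord_le_enorm {R : realType} {n : nat} (x : 'rV[R]_n) (i : 'I_n) :
  `|x 0 i| <= enorm x.
Proof.
rewrite /enorm -sqrtr_sqr ler_sqrt; last first.
  by apply: sumr_ge0 => j _; exact: sqr_ge0.
rewrite (bigD1 i) //= lerDl.
by apply: sumr_ge0 => j _; exact: sqr_ge0.
Qed.

Lemma enormZ {R : realType} {n : nat} (a : R) (x : 'rV[R]_n) :
  enorm (a *: x) = `|a| * enorm x.
Proof.
rewrite /enorm -sqrtr_sqr -sqrtrM ?sqr_ge0 // mulr_sumr.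
by congr Num.sqrt; apply: eq_bigr => i _; rewrite mxE exprMn.
Qed.

(** The topology of ['rV[R]_n] comes from the sup norm; as the Euclidean norm
    dominates it, every neighbourhood contains a closed Euclidean ball. *)
Lemma near_enorm {R : realType} {n : nat} {x : 'rV[R]_n}
    {P : 'rV[R]_n -> Prop} :
  (\forall y \near x, P y) ->
  exists2 d : R, 0 < d & forall y, enorm (y - x) <= d -> P y.
Proof.
move=> /nbhs_ballP[e /= e0 xP]; exists (e / 2); first by rewrite divr_gt0.
move=> y yx; apply: xP; rewrite mx_norm_ball /ball_ /=.
rewrite distrC [ltLHS]mx_normrE; apply/bigmax_ltP; split=> //= -[i j] _ /=.
rewrite ord1; apply: le_lt_trans (coord_le_enorm _ _) _.
by apply: (le_lt_trans yx); rewrite ltr_pdivrMr // ltr_pMr // ltr1n.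
Qed.

(** Nothing is asked of [y] at the zero coordinates of [x]: this asymmetry is
    what makes the condition hold in a neighbourhood of [x]. *)
Definition preserves_signs {R : realType} {n : nat} (x y : 'rV[R]_n) : Prop :=
  forall i, (0 < x 0 i -> 0 < y 0 i) /\ (x 0 i < 0 -> y 0 i < 0).

Lemma near_preserves_signs {R : realType} {n : nat} (x : 'rV[R]_n) :
  \forall y \near x, preserves_signs x y.
Proof.
apply: (@filter_forall _ _ (fun i (y : 'rV[R]_n) =>
  (0 < x 0 i -> 0 < y 0 i) /\ (x 0 i < 0 -> y 0 i < 0)) (nbhs x)) => i.
have xi : (fun y : 'rV[R]_n => y 0 i) @ x --> x 0 i by exact: coord_continuous.
have [x0|x0|_] := ltgtP (x 0 i) 0; last by apply: nearW.
- by apply: filterS (cvgr_lt _ xi _ x0) => y.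
- by apply: filterS (cvgr_gt _ xi _ x0) => y.
Qed.

Lemma num_pos_le {R : realType} {n : nat} {x y : 'rV[R]_n} :
  preserves_signs x y -> (num_pos x <= num_pos y)%N.
Proof.
move=> xy; apply: subset_leq_card; apply/fintype.subsetP => i; rewrite !inE.
by have [] := xy i.
Qed.

Lemma num_neg_le {R : realType} {n : nat} {x y : 'rV[R]_n} :
  preserves_signs x y -> (num_neg x <= num_neg y)%N.
Proof.
move=> xy; apply: subset_leq_card; apply/fintype.subsetP => i; rewrite !inE.
by have [] := xy i.
Qed.

(** A coordinate of [y] can acquire a sign only where [x] is nonzero, and there
    it has the sign of [x]; so [x] and [y] have the same sign pattern. *)
Lemma num_same_support {R : realType} {n : nat} {x y : 'rV[R]_n} :
  preserves_signs x y -> (forall i, i \in (~: Gamma x)%SET -> y 0 i = 0) ->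
  num_pos y = num_pos x /\ num_neg y = num_neg x.
Proof.
move=> xy y0.
have xi0 i : x 0 i = 0 -> y 0 i = 0.
  by move=> xi; apply: y0; rewrite !inE xi eqxx.
have sgE i : (0 < y 0 i) = (0 < x 0 i) /\ (y 0 i < 0) = (x 0 i < 0).
  have [pos neg] := xy i; case: (ltgtP (x 0 i) 0) => [/neg|/pos|/xi0 ->].
  - by move=> yi; rewrite yi (lt_gtF yi).
  - by move=> yi; rewrite yi (lt_gtF yi).
  - by rewrite ltxx.
by split; apply: eq_card => i; rewrite !inE; have [] := sgE i.
Qed.

(** Neither count drops from [x] to [y], and the new nonzero coordinate [i]
    raises one of them by at least one; which of the two depends on the sign of
    [y 0 i], whence the minimum. *)
Lemma penalty_gap {R : realType} {n : nat} {lambda1 lambda2 : R}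
    {x y : 'rV[R]_n} {i : 'I_n} :
  0 < lambda1 -> 0 < lambda2 -> preserves_signs x y ->
  x 0 i = 0 -> y 0 i != 0 ->
  lambda1 * (num_pos x)%:R + lambda2 * (num_neg x)%:R
    + Num.min lambda1 lambda2
  <= lambda1 * (num_pos y)%:R + lambda2 * (num_neg y)%:R.
Proof.
move=> l10 l20 xy xi0; rewrite neq_lt => /orP[yi|yi].
- have lt_neg : (num_neg x < num_neg y)%N.
    apply: proper_card; apply/properP; split; last first.
      by exists i; rewrite inE ?xi0 ?ltxx.
    by apply/fintype.subsetP => j; rewrite !inE; have [] := xy j.
  rewrite -addrA lerD //; first by rewrite ler_pM2l // ler_nat num_pos_le.
  apply: (@le_trans _ _ (lambda2 * (num_neg x).+1%:R)).
    by rewrite -natr1 mulrDr mulr1 lerD2l ge_min lexx orbT.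
  by rewrite ler_pM2l // ler_nat.
- have lt_pos : (num_pos x < num_pos y)%N.
    apply: proper_card; apply/properP; split; last first.
      by exists i; rewrite inE ?xi0 ?ltxx.
    by apply/fintype.subsetP => j; rewrite !inE; have [] := xy j.
  rewrite addrAC lerD //; last by rewrite ler_pM2l // ler_nat num_neg_le.
  apply: (@le_trans _ _ (lambda1 * (num_pos x).+1%:R)).
    by rewrite -natr1 mulrDr mulr1 lerD2l ge_min lexx.
  by rewrite ler_pM2l // ler_nat.
Qed.

Lemma box_conv {R : realType} {n : nat} {l u : 'I_n -> \bar R}
    {t : R} {x y : 'rV[R]_n} :
  0 <= t <= 1 -> box l u x -> box l u y ->
  box l u (t *: x + (1 - t) *: y).
Proof.
move=> /andP[t0 t1] lux luy i; rewrite !mxE.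
have avg r : r = t * r + (1 - t) * r by rewrite -mulrDl addrC subrK mul1r.
have [lx xu] := lux i; have [ly yu] := luy i; split.
- case: (l i) lx ly => [r||]; rewrite ?leNye ?leye_eq // !lee_fin => lx ly.
  by rewrite [leLHS]avg lerD // ler_wpM2l // subr_ge0.
- case: (u i) xu yu => [r||]; rewrite ?leey ?leeNy_eq // !lee_fin => xu yu.
  by rewrite [leRHS]avg lerD // ler_wpM2l // subr_ge0.
Qed.

(** The convexity inequality for a real parameter [t] in place of a bundled
    element of the unit interval. *)
Lemma convex_function_segment {R : realType} {n : nat} {f : 'rV[R]_n -> R}
    {t : R} (x y : 'rV[R]_n) :
  convex_function [set: 'rV[R]_n] f -> 0 <= t <= 1 ->
  f (t *: x + (1 - t) *: y) <= t * f x + (1 - t) * f y.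
Proof.
move=> f_convex /andP[t0 t1].
by have := f_convex (Itv01 t0 t1) x y; rewrite !in_setT; exact.
Qed.

Lemma segment_near {R : realType} {n : nat} {d : R} (x y : 'rV[R]_n) :
  0 < d -> exists2 t : R, 0 < t <= 1 &
    enorm (t *: x + (1 - t) *: y - y) <= d.
Proof.
move=> d0; set e := enorm (x - y).
have e0 : 0 <= e by exact: sqrtr_ge0.
have de0 : 0 < d + e by rewrite ltr_wpDr.
have t0 : 0 < d / (d + e) by rewrite divr_gt0.
(* This t is at most 1 and satisfies t * e <= d, also when e = 0. *)
exists (d / (d + e)).
  by rewrite t0 ler_pdivrMr // mul1r lerDl.
rewrite scalerBl scale1r addrCA addrAC subrr add0r -scalerBr enormZ (gtr0_norm t0).
by rewrite mulrAC ler_pdivrMr // ler_pM2l // lerDr ltW.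
Qed.

Theorem proposition3p1 (R : realType) (n : nat)
    (f : 'rV[R]_n -> R) (Lf : R)
    (f_convex : convex_function [set: 'rV[R]_n] f)
    (f_diff : forall x : 'rV[R]_n, differentiable f x)
    (f_lip : gradient_lipschitz Lf f)
    (l u : 'I_n -> \bar R)
    (l_le0 : forall i, (l i <= 0)%E)
    (u_ge0 : forall i, (0 <= u i)%E)
    (l_lt_u : forall i, (l i < u i)%E)
    (lambda1 lambda2 : R)
    (lambda1_gt0 : 0 < lambda1) (lambda2_gt0 : 0 < lambda2)
    (xs : 'rV[R]_n) (xs_box : box l u xs) :
  local_minimizer (box l u) (objective f lambda1 lambda2) xs <->
  global_minimizer (vanishing_on (box l u) (~: Gamma xs)%SET) f xs.
Proof.
have xs0 i : i \in (~: Gamma xs)%SET -> xs 0 i = 0.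
  by rewrite !inE negbK => /eqP.
have [d1 d1_gt0 signs] := near_enorm (near_preserves_signs xs).
split=> [[_ [d d0 xs_min]]|[_ xs_min]].
- split=> // x [x_box x0].
  have dd0 : 0 < Num.min d d1 by rewrite lt_min d0.
  have [t /andP[t0 t1]] := segment_near x xs dd0.
  rewrite le_min => /andP[zd zd1].
  have t01 : 0 <= t <= 1 by rewrite ltW.
  have z0 i : i \in (~: Gamma xs)%SET -> (t *: x + (1 - t) *: xs) 0 i = 0.
    by move=> iG; rewrite !mxE x0 // xs0 // !mulr0 addr0.
  have [posE negE] := num_same_support (signs _ zd1) z0.
  have := xs_min _ (box_conv t01 x_box xs_box) zd.
  rewrite /objective posE negE !lerD2r => fz.
  have := le_trans fz (convex_function_segment x xs f_convex t01).
  (* f xs <= t * f x + (1 - t) * f xs means t * f xs <= t * f x. *)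
  by rewrite mulrBl mul1r addrCA lerDl subr_ge0 ler_pM2l.
- split=> //.
  have l0 : 0 < Num.min lambda1 lambda2 by rewrite lt_min lambda1_gt0.
  have f_near : \forall y \near xs, f xs - Num.min lambda1 lambda2 < f y.
    apply: cvgr_gt (differentiable_continuous (f_diff xs)) _ _.
    by rewrite ltrBlDr ltrDl.
  have [d2 d2_gt0 f_drop] := near_enorm f_near.
  exists (Num.min d1 d2); first by rewrite lt_min d1_gt0.
  move=> x x_box; rewrite le_min => /andP[/signs xs_x /f_drop fx].
  rewrite /objective -!addrA.
  have [x0|] := pselect (forall i, i \in (~: Gamma xs)%SET -> x 0 i = 0).
    by have [-> ->] := num_same_support xs_x x0; rewrite lerD2r xs_min.
  move=> /existsNP[i /not_implyP[iG /eqP xi]].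
  have gap := penalty_gap lambda1_gt0 lambda2_gt0 xs_x (xs0 i iG) xi.
  apply: le_trans (lerD (ltW fx) gap).
  by rewrite [leRHS]addrCA subrK addrC.
Qed.
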